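(* Let $k > \ell \ge 2$ be fixed integers and let $\delta > 0$ be a fixed constant. Suppose $\lambda = \lambda(n)$ is a positive integer with $0 < \lambda < n^{\frac{\ell-1}{k-2} - \delta}$. Then $$f(n,k,\ell,\lambda) = \Omega\left(\left(\frac{n^{k-\ell}}{\lambda}\right)^{\frac{1}{k-1}} (\log n)^{\frac{1}{k-1}}\right),$$ where the implied constant depends only on $k,\ell,\delta$.
   Context: A $k$-graph is a family of $k$-element subsets (edges) of a finite vertex set. A set of vertices is independent if it contains no edge; $\alpha(\mathcal{H})$ is the maximum size of an independent set. For integers $k > \ell \ge 1$ and $\lambda \ge 1$, an $(n,k,\ell,\lambda)$-system is a $k$-graph on $n$ vertices in which every set of $\ell$ vertices is contained in at most $\lambda$ edges. $f(n,k,\ell,\lambda)$ is the minimum of $\alpha(\mathcal{H})$ over all $(n,k,\ell,\lambda)$-systems $\mathcal{H}$. *)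

(* Defs.v *)
From mathcomp Require Import all_boot.

Set Implicit Arguments.
Unset Strict Implicit.
Unset Printing Implicit Defensive.

Section Hypergraphs.
Variable T : finType.
Implicit Types (H : {set {set T}}) (S : {set T}).

Definition kgraph (k : nat) H : bool := [forall e in H, #|e| == k].

Definition independent H S : bool := [forall e in H, ~~ (e \subset S)].

Definition alpha H : nat := \max_(S : {set T} | independent H S) #|S|.

Definition is_system (k l lam : nat) H : bool :=
  kgraph k H &&
  [forall L : {set T}, (#|L| == l) ==> (#|[set e in H | L \subset e]| <= lam)].

End Hypergraphs.

(* The edgeless graph [set0] is always a system, so the minimum is taken over
   a nonempty set; see [fsys_attained] and [fsys_le]. *)
Definition fsys (n k l lam : nat) : nat :=
  alpha [arg min_(H < (set0 : {set {set 'I_n}}) | is_system k l lam H) alpha H].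

Lemma is_system0 (T : finType) (k l lam : nat) :
  is_system k l lam (set0 : {set {set T}}).
Proof.
apply/andP; split; first by apply/forall_inP => e; rewrite inE.
apply/forall_inP => L _; rewrite (_ : [set e in _ | _] = set0) ?cards0 //.
by apply/setP => e; rewrite !inE.
Qed.

Lemma fsys_attained (n k l lam : nat) :
  exists2 H : {set {set 'I_n}}, is_system k l lam H & alpha H = fsys n k l lam.
Proof.
rewrite /fsys; case: arg_minnP; first exact: is_system0.
by move=> H sysH _; exists H.
Qed.

Lemma fsys_le (n k l lam : nat) (H : {set {set 'I_n}}) :
  is_system k l lam H -> fsys n k l lam <= alpha H.
Proof.
move=> sysH; rewrite /fsys; case: arg_minnP; first exact: is_system0.
by move=> H0 _; apply.
Qed.

(* Main.v *)
Require Import Defs.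
From HB Require Import structures.
From mathcomp Require Import all_boot all_order all_algebra.
From mathcomp Require Import zify ring lra.

Set Implicit Arguments.
Unset Strict Implicit.
Unset Printing Implicit Defensive.

Import Order.TTheory GRing.Theory Num.Theory.
Local Open Scope ring_scope.

(** A random induced subgraph of density [q], slightly denser than
    [D ^ (- 1 / (k-1))] where [D = lam * n ^ (l-1)] bounds the degrees, contains
    fewer overlapping pairs of edges and triangles than vertices; this is what
    the hypothesis on [lam] is for. Deleting a vertex from each of them leaves a
    triangle-free hypergraph.

    In a triangle-free hypergraph a Shearer-type greedy induction gains the
    logarithm. When vertices are put into the independent set their edges shrink,
    so one tracks a set [V] of remaining vertices and a set [I] of chosen ones, with
    potential [z |V| - w * sum_e z ^ |e :&: V|], and shows that it is at most a
    constant times the number of vertices that can still be chosen. If deleting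
    some vertex does not decrease the potential, delete it; hence every weighted
    degree may be assumed to be at most [z]. If a slightly larger pair [(z, w)] does
    not decrease the potential, use that pair; hence the average of [z] minus the
    weighted degree may be assumed to be [O(w z)]. Choosing a random vertex and deleting
    its neighbours along edges of current size 2 then costs only [O(1)] on average.
    Starting from [w = 1] and going down to [w = 1 / N] while [z] decreases by a factor
    of about [exp N] yields an independent set of size [Omega(z |V|)] with
    [z] of order [(N / degree) ^ (1 / (k-1))], where [N] is of order [log n]. *)

(** * Greedy selection in triangle-free hypergraphs *)

Section Greedy.
Variables (T : finType) (R : realFieldType) (H : {set {set T}}).
Implicit Types (V I e f g : {set T}) (a b c u v x : T) (w z C : R).

(** This excludes Berge triangles only: two distinct edges may still share several vertices. *)
Definition triangle_free : Prop :=
  forall e f g a b c, e \in H -> f \in H -> g \in H ->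
    a != b -> b != c -> a != c -> a \in e -> a \in f -> b \in f -> b \in g ->
    c \in g -> c \in e -> [\/ e = f, f = g | e = g].

(** Vertices outside [V :|: I] are discarded for good, so only these edges can still end up inside
    the independent set. *)
Definition live V I : {set {set T}} := [set e in H | e \subset V :|: I].

(** Current sizes of at least 2 mean that no single remaining vertex completes an edge. Once [V] is
    empty, no edge is live and [I] is independent. *)
Definition valid V I : Prop :=
  [disjoint V & I] /\ forall e, e \in live V I -> (2 <= #|e :&: V|)%N.

(** For [w = 1] this is the mean number of vertices minus live edges surviving in a random subset of
    [V] of density [z], as in the deletion method; [w < 1] discounts the edges. *)
Definition pot w z V I : R :=
  z * #|V|%:R - w * \sum_(e in live V I) z ^+ #|e :&: V|.

Definition wdeg w z V I u : R :=
  w * \sum_(e in live V I | u \in e) z ^+ #|e :&: V|.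

(** These are the vertices that become forbidden once [v] is chosen. *)
Definition nbr V I v : {set T} :=
  [set u in V | (u != v) && [exists e in live V I, e :&: V == [set v; u]]].

Lemma nbrP V I v u :
  reflect [/\ u \in V, u != v & exists2 e, e \in live V I & e :&: V = [set v; u]]
          (u \in nbr V I v).
Proof.
rewrite inE; apply: (iffP and3P) => [[uV uv /exists_inP[e eL /eqP E]]|[uV uv [e eL E]]].
  by split=> //; exists e.
by split=> //; apply/exists_inP; exists e => //; apply/eqP.
Qed.

Lemma nbr_sym V I v u : v \in V -> u \in nbr V I v -> v \in nbr V I u.
Proof.
move=> vV /nbrP[uV uv [e eL E]]; apply/nbrP; split=> //; first by rewrite eq_sym.
by exists e => //; rewrite E setUC.
Qed.

Lemma live_delete V I u : [disjoint V & I] -> u \in V ->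
  live (V :\ u) I = [set e in live V I | u \notin e].
Proof.
move=> dVI uV; apply/setP => e; rewrite !inE -andbA; congr (_ && _).
have uI : u \notin I by rewrite (disjointFr dVI uV).
apply/idP/andP => [/subsetP sub|[/subsetP sub ue]].
  split; last by apply/negP => /sub; rewrite !inE eqxx (negbTE uI).
  by apply/subsetP => x /sub; rewrite !inE => /orP[/andP[_ ->]|->]; rewrite ?orbT.
apply/subsetP => x xe; have := sub x xe; rewrite !inE => /orP[xV|->]; last by rewrite orbT.
by rewrite xV andbT; apply/orP; left; apply: contra ue => /eqP <-.
Qed.

Lemma setID1_out V e u : u \notin e -> e :&: (V :\ u) = e :&: V.
Proof.
move=> ue; apply/setP => x; rewrite !inE; case: eqP => [->|] //=.
by rewrite (negbTE ue).
Qed.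

Lemma valid_delete V I u : valid V I -> u \in V -> valid (V :\ u) I.
Proof.
move=> [dVI val] uV; split.
  by apply: disjointWl dVI; apply: subsetDl.
by move=> e; rewrite live_delete // inE => /andP[/val ? ue]; rewrite setID1_out.
Qed.

Lemma pot_delete w z V I u : valid V I -> u \in V ->
  pot w z (V :\ u) I = pot w z V I - z + wdeg w z V I u.
Proof.
move=> [dVI val] uV; rewrite /pot /wdeg live_delete //.
rewrite (cardsD1 u V) uV add1n -natr1.
rewrite (eq_bigl (fun e => (e \in live V I) && (u \notin e))); last by move=> e; rewrite !inE.
under eq_bigr => e /andP[_ ue] do rewrite setID1_out //.
rewrite [X in _ = _ - w * X - _ + _](bigID (fun e => u \in e)) /=; ring.
Qed.

Lemma sum_wdeg w z V I :
  \sum_(u in V) wdeg w z V I u = w * \sum_(e in live V I) #|e :&: V|%:R * z ^+ #|e :&: V|.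
Proof.
rewrite /wdeg -big_distrr /=; congr (_ * _).
rewrite (exchange_big_dep (fun e => e \in live V I)) /=; last by move=> u e _ /andP[].
apply: eq_bigr => e eL; rewrite mulr_natl -sumr_const.
by apply: eq_bigl => u; rewrite in_setI eL /= andbC.
Qed.

Hypothesis triH : triangle_free.

(** Two such vertices [a], [b] would close a triangle with the edges of current size 2 joining them
    to [v]. The three edges are distinct, since each of the latter two contains only one of [a],
    [b]. *)
Lemma live_nbr V I v e : valid V I -> v \in V -> e \in live V I ->
  (#|e :&: nbr V I v| <= 1)%N.
Proof.
move=> [dVI val] vV eL; rewrite leqNgt; apply/negP => /card_gt1P[a [b [aN bN ab]]].
move: aN bN; rewrite !in_setI => /andP[ae /nbrP[aV av [f fL fE]]] /andP[be /nbrP[bV bv [g gL gE]]].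
have inH h : h \in live V I -> h \in H by rewrite inE => /andP[].
have af : a \in f by have := set22 v a; rewrite -fE inE => /andP[].
have vf : v \in f by have := set21 v a; rewrite -fE inE => /andP[].
have bg : b \in g by have := set22 v b; rewrite -gE inE => /andP[].
have vg : v \in g by have := set21 v b; rewrite -gE inE => /andP[].
have bf : b \notin f.
  apply/negP => bf; have : b \in [set v; a] by rewrite -fE inE bf.
  by rewrite !inE (negbTE bv) eq_sym (negbTE ab).
have ag : a \notin g.
  apply/negP => ag; have : a \in [set v; b] by rewrite -gE inE ag.
  by rewrite !inE (negbTE av) (negbTE ab).
have vb : v != b by rewrite eq_sym.
have [E|E|E] := triH (inH _ eL) (inH _ fL) (inH _ gL) av vb ab ae af vf vg bg be.
- by rewrite -E be in bf.
- by rewrite E bg in bf.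
- by rewrite -E ae in ag.
Qed.

Lemma live_step V I v : [disjoint V & I] -> v \in V ->
  live (V :\: (v |: nbr V I v)) (v |: I)
    = [set e in live V I | [disjoint e & nbr V I v]].
Proof.
move=> dVI vV; apply/setP => e; rewrite !inE -andbA; congr (_ && _).
have vN : v \notin nbr V I v by apply/negP => /nbrP[_ /eqP].
have -> : V :\: (v |: nbr V I v) :|: (v |: I) = (V :|: I) :\: nbr V I v.
  apply/setP => x; rewrite in_setU in_setD in_setU1 in_setD in_setU1 in_setU.
  have [->|xv] /= := eqVneq x v; first by rewrite vN vV.
  have [xN|] //= := boolP (x \in nbr V I v).
  by case/nbrP: xN => xV _ _; rewrite (disjointFr dVI xV).
by rewrite subsetD.
Qed.

Lemma setI_step V I v e : [disjoint e & nbr V I v] ->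
  e :&: (V :\: (v |: nbr V I v)) = (e :&: V) :\ v.
Proof.
move=> dis; apply/setP => x; rewrite in_setI in_setD in_setU1 in_setD1 in_setI negb_or.
have [xe|] /= := boolP (x \in e); last by rewrite andbF.
by rewrite (disjointFr dis xe) andbT.
Qed.

(** An edge through [v] whose current size would drop to 1 has its other vertex in [nbr V I v], so
    it dies with that vertex. *)
Lemma valid_step V I v : valid V I -> v \in V ->
  valid (V :\: (v |: nbr V I v)) (v |: I).
Proof.
move=> vVI vV; have [dVI val] := vVI; split.
  rewrite disjoint_subset; apply/subsetP => x; rewrite in_setD in_setU1 negb_or.
  move=> /andP[/andP[xv _] xV]; rewrite inE in_setU1 negb_or xv /=.
  by rewrite (disjointFr dVI xV).
move=> e; rewrite live_step // inE => /andP[eL dis]; rewrite setI_step //.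
have := val e eL; rewrite (cardsD1 v (e :&: V)) inE vV andbT.
have [ve|//] := boolP (v \in e); rewrite add1n !ltnS leq_eqVlt => /orP[|//].
move=> /eqP/esym/eqP/cards1P[u E].
have : u \in (e :&: V) :\ v by rewrite E inE.
rewrite !inE => /and3P[uv ue uV].
have : u \in nbr V I v.
  apply/nbrP; split => //; exists e => //.
  by rewrite -(setD1K (_ : v \in e :&: V)) ?inE ?ve // E.
by rewrite (disjointFr dis ue).
Qed.

(** Choosing [v] costs [z], and each edge through [v] grows in weight by the factor [1 / z].
    Deleting a neighbour [u] costs [z - wdeg u]; these costs add up because, by [live_nbr], no live
    edge is counted for two neighbours. The comparison is made edge by edge. *)
Lemma pot_step w z V I v : 0 <= w -> 0 < z -> z <= 1 -> valid V I -> v \in V ->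
  pot w z V I - z - wdeg w z V I v / z
    - \sum_(u in nbr V I v) (z - wdeg w z V I u)
  <= pot w z (V :\: (v |: nbr V I v)) (v |: I).
Proof.
move=> w0 z0 z1 vVI vV; have [dVI val] := vVI.
have vN : v \notin nbr V I v by apply/negP => /nbrP[_ /eqP].
have cV : #|V|%:R = #|V :\: (v |: nbr V I v)|%:R + 1 + #|nbr V I v|%:R :> R.
  rewrite natr1 -natrD; congr _%:R.
  have sub : v |: nbr V I v \subset V.
    by apply/subsetP => x; rewrite in_setU1 => /orP[/eqP->//|/nbrP[]].
  have := subset_leq_card sub.
  by rewrite -(cardsID (v |: nbr V I v) V) (setIidPr sub) cardsU1 vN; lia.
rewrite sumrB sumr_const -mulr_natl /pot.
have -> : \sum_(u in nbr V I v) wdeg w z V I u =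
    w * \sum_(e in live V I) #|e :&: nbr V I v|%:R * z ^+ #|e :&: V|.
  rewrite /wdeg -big_distrr /=; congr (_ * _).
  rewrite (exchange_big_dep (fun e => e \in live V I)) /=; last by move=> u e _ /andP[].
  apply: eq_bigr => e eL; rewrite mulr_natl -sumr_const.
  by apply: eq_bigl => u; rewrite in_setI eL /= andbC.
suff key : \sum_(e in live (V :\: (v |: nbr V I v)) (v |: I))
      z ^+ #|e :&: (V :\: (v |: nbr V I v))| <=
    \sum_(e in live V I) z ^+ #|e :&: V|
    - \sum_(e in live V I) #|e :&: nbr V I v|%:R * z ^+ #|e :&: V|
    + (\sum_(e in live V I | v \in e) z ^+ #|e :&: V|) / z.
  have := ler_wpM2l w0 key; rewrite -subr_ge0 => h.
  rewrite -subr_ge0 cV /wdeg; apply: le_trans h _; rewrite le_eqVlt.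
  by apply/orP; left; apply/eqP; ring.
rewrite live_step // (eq_bigl (fun e => (e \in live V I) && [disjoint e & nbr V I v]));
  last by move=> e; rewrite !inE.
rewrite big_mkcondr /= [X in _ + X / z]big_mkcondr /= big_distrl /= -sumrB -big_split /=.
apply: ler_sum => e eL.
have W0 : 0 <= z ^+ #|e :&: V| by apply: exprn_ge0; apply: ltW.
have X0 : 0 <= (if v \in e then z ^+ #|e :&: V| else 0) / z.
  by apply: divr_ge0; [case: ifP|apply: ltW].
have [dis|ndis] := boolP [disjoint e & nbr V I v].
  have -> : e :&: nbr V I v = set0 by apply/eqP; rewrite setI_eq0.
  rewrite cards0 mul0r subr0 setI_step //.
  have [ve|ve] := boolP (v \in e).
    rewrite (cardsD1 v (e :&: V)) inE ve vV add1n exprS mulrAC divff ?gt_eqF // mul1r.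
    by rewrite lerDr mulr_ge0 ?exprn_ge0 // ltW.
  rewrite mul0r addr0 (_ : (e :&: V) :\ v = e :&: V) //.
  by apply/setDidPl; rewrite disjoint_sym disjoints1 inE (negbTE ve).
have := live_nbr vVI vV eL; case: #|e :&: nbr V I v| => [|[|//]] _.
  by rewrite mul0r subr0 addr_ge0.
by rewrite mul1r subrr add0r.
Qed.

Lemma nbr_card_le w z V I v : 0 <= w -> 0 < z -> v \in V ->
  #|nbr V I v|%:R * (w * z ^+ 2) <= wdeg w z V I v.
Proof.
move=> w0 z0 vV; rewrite /wdeg mulrCA; apply: ler_wpM2l => //.
pose E2 := [set e in live V I | (v \in e) && (#|e :&: V| == 2)].
have leE2 : (#|nbr V I v| <= #|E2|)%N.
  (* On [E2] the picked vertex is the end of the edge other than [v], so the default is never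
     reached there. *)
  pose other e := odflt v [pick y in (e :&: V) :\ v].
  apply: leq_trans (leq_imset_card other E2).
  apply/subset_leq_card/subsetP => u /nbrP[uV uv [e eL eE]].
  apply/imsetP; exists e.
    rewrite inE eL eE cards2 (eq_sym v u) uv /= andbT.
    by have := set21 v u; rewrite -eE inE => /andP[].
  have -> : other e = odflt v [pick y in [set u]].
    rewrite /other (_ : (e :&: V) :\ v = [set u]) // eE.
    apply/setP => x; rewrite !inE; have [->|] //= := eqVneq x v.
    by rewrite eq_sym (negbTE uv).
  by case: pickP => [y|/(_ u)]; rewrite inE ?eqxx // => /eqP.
have z2 : 0 <= z ^+ 2 by apply: exprn_ge0; apply: ltW.
apply: (@le_trans _ _ (#|E2|%:R * z ^+ 2)).
  by apply: ler_wpM2r => //; rewrite ler_nat.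
rewrite mulr_natl -sumr_const.
rewrite (eq_bigl (fun e => ((e \in live V I) && (v \in e)) && (#|e :&: V| == 2)));
  last by move=> e; rewrite !inE !andbA.
rewrite big_mkcondr /=; apply: ler_sum => e _.
by case: eqP => [->//|_]; apply: exprn_ge0; apply: ltW.
Qed.

(* Deleting the neighbourhood of a random vertex costs the total slack
   [z - wdeg u] weighted by [#|nbr u| <= 1 / (w z)], so only the average slack
   matters and no correlation between the degrees of different edge sizes is needed. *)
Lemma exists_good_step w z C V I : 0 < w -> 0 < z -> z <= 1 -> 0 <= C ->
  valid V I -> V != set0 ->
  (forall u, u \in V -> wdeg w z V I u <= z) ->
  \sum_(u in V) (z - wdeg w z V I u) <= C * w * z * #|V|%:R ->
  exists2 v, v \in V &
    pot w z V I - (2 + C) <= pot w z (V :\: (v |: nbr V I v)) (v |: I).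
Proof.
move=> w0 z0 z1 C0 vVI Vn0 hdeg hsl.
apply/exists_inP; apply: contraT; rewrite negb_exists_in => /forall_inP hno.
have hlt v : v \in V -> 2 + C <
    z + wdeg w z V I v / z + \sum_(u in nbr V I v) (z - wdeg w z V I u).
  move=> vV; have := hno v vV; rewrite -ltNge.
  have := pot_step (ltW w0) z0 z1 vVI vV; lra.
have [v0 v0V] : exists v0, v0 \in V by apply/set0Pn.
have : \sum_(v in V) (2 + C) <
    \sum_(v in V) (z + wdeg w z V I v / z + \sum_(u in nbr V I v) (z - wdeg w z V I u)).
  apply: ltr_sum; last exact: hlt.
  by apply/hasP; exists v0; rewrite ?mem_index_enum.
rewrite ltNge => /negP[].
have sumc (x : R) : \sum_(v in V) x = x * #|V|%:R by rewrite sumr_const mulr_natr.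
rewrite !big_split /= !sumc -mulr_suml.
(* Double counting over the symmetric relation [nbr]. *)
have -> : \sum_(v in V) \sum_(u in nbr V I v) (z - wdeg w z V I u)
    = \sum_(u in V) #|nbr V I u|%:R * (z - wdeg w z V I u).
  rewrite (exchange_big_dep (fun u => u \in V)) /=; last by move=> v u _ /nbrP[].
  apply: eq_bigr => u uV; rewrite mulr_natl -sumr_const; apply: eq_bigl => v.
  apply/andP/idP => [[vV]|vN]; first exact: nbr_sym.
  by case/nbrP: (vN) => vV _ _; split=> //; apply: nbr_sym.
have S1 : \sum_(u in V) wdeg w z V I u <= z * #|V|%:R.
  by rewrite mulr_natr -sumr_const; apply: ler_sum => u /hdeg.
have wz : 0 < w * z by apply: mulr_gt0.
have S2 : \sum_(u in V) #|nbr V I u|%:R * (z - wdeg w z V I u) <= C * #|V|%:R.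
  rewrite -(ler_pM2l wz) (_ : w * z * (C * _) = C * w * z * #|V|%:R); last by ring.
  apply: le_trans hsl; rewrite big_distrr /=; apply: ler_sum => u uV.
  have d0 := hdeg u uV; rewrite mulrA ler_piMl ?subr_ge0 //.
  have := nbr_card_le I (ltW w0) z0 uV.
  have -> : #|nbr V I u|%:R * (w * z ^+ 2) = z * (w * z * #|nbr V I u|%:R) by ring.
  by move=> h; have := le_trans h d0; rewrite ger_pMr.
have n0 : 0 <= #|V|%:R :> R by [].
have S3 : (\sum_(u in V) wdeg w z V I u) / z <= #|V|%:R by rewrite ler_pdivrMr // mulrC.
have S4 : z * #|V|%:R <= #|V|%:R by rewrite ler_piMl.
move: S2 S3 S4.
move: (\sum_(u in V) #|_|%:R * _) (_ / z) (z * _) => s2 s3 s4; move: #|V|%:R => n.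
lra.
Qed.

(** The last coefficient is the sum of the binomials of order at least 2, whose powers of [h] are
    all at most [h ^+ 2]. *)
Lemma exprD1_le_quadratic (h : R) j : 0 <= h -> h <= 1 ->
  (1 + h) ^+ j <= 1 + j%:R * h + (2 ^+ j - 1 - j%:R) * h ^+ 2.
Proof.
move=> h0 h1; elim: j => [|j IH]; first by rewrite !expr0; lra.
have c0 : 0 <= 2 ^+ j - 1 - j%:R :> R.
  by rewrite -natrX -addrA -opprD nat1r subr_ge0 ler_nat ltn_expl.
move: c0 IH; rewrite !exprS -[j.+1%:R]natr1.
move: (2 ^+ j) ((1 + h) ^+ j) (j%:R) => a b c c0 IH.
have h2 : 0 <= h ^+ 2 by apply: exprn_ge0.
have : 0 <= (a - 1 - c) * h ^+ 2 * (1 - h) by rewrite !mulr_ge0 // subr_ge0.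
have : (1 + h) * b <= (1 + h) * (1 + c * h + (a - 1 - c) * h ^+ 2).
  by apply: ler_wpM2l => //; lra.
by nra.
Qed.

Lemma exprD1_le_pow2 (h t : R) j k : 0 <= h -> h <= 1 -> 0 <= t -> (j <= k)%N ->
  (1 + t) * (1 + h) ^+ j <= 1 + j%:R * h + 2 ^+ k * (h ^+ 2 + t).
Proof.
move=> h0 h1 t0 jk.
have e1 := exprD1_le_quadratic j h0 h1.
have e2 : (1 + h) ^+ j <= 2 ^+ k.
  apply: (@le_trans _ _ (2 ^+ j)); last by apply: ler_weXn2l => //; lra.
  by apply: lerXn2r; rewrite ?nnegrE; lra.
have e3 : 2 ^+ j <= 2 ^+ k :> R by apply: ler_weXn2l => //; lra.
have h2 : 0 <= h ^+ 2 by apply: exprn_ge0.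
have e4 : (2 ^+ j - 1 - j%:R) * h ^+ 2 <= 2 ^+ k * h ^+ 2.
  by apply: ler_wpM2r => //; have : 0 <= j%:R :> R by []; lra.
have e5 : t * (1 + h) ^+ j <= t * 2 ^+ k by apply: ler_wpM2l.
by lra.
Qed.

(* If raising the parameters [z] and [w] slightly does not increase the potential,
   then the potential is nearly stationary and the average slack is small. *)
Lemma slack_le (w z h t : R) k V I : 0 < w -> 0 < z -> 0 < h -> h <= 1 -> 0 <= t ->
  h <= w -> t <= 2 * h * w -> valid V I -> (forall e, e \in H -> #|e| <= k)%N ->
  (forall u, u \in V -> wdeg w z V I u <= z) ->
  pot (w * (1 + t)) (z * (1 + h)) V I < pot w z V I ->
  \sum_(u in V) (z - wdeg w z V I u) <= 3 * 2 ^+ k * w * z * #|V|%:R.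
Proof.
move=> w0 z0 h0 h1 t0 hw thw [dVI val] hk hdeg; rewrite /pot.
have S1 : \sum_(u in V) wdeg w z V I u <= z * #|V|%:R.
  by rewrite mulr_natr -sumr_const; apply: ler_sum => u /hdeg.
rewrite sumrB sumr_const; move: S1; rewrite sum_wdeg.
set A := w * \sum_(e in _) _%:R * _; set B := \sum_(e in _) z ^+ _.
set B' := \sum_(e in _) (z * (1 + h)) ^+ _ => S1.
(* Current sizes are at least 1, so the total edge weight is at most the total weighted degree,
   hence at most [z * #|V|]. *)
have BA : w * B <= A.
  rewrite /A ler_pM2l //; apply: ler_sum => e /val e2.
  by rewrite ler_peMl ?exprn_ge0 ?(ltW z0) // ler1n ltnW.
have B'le : w * (1 + t) * B' <= w * B + h * A + 2 ^+ k * (h ^+ 2 + t) * (w * B).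
  rewrite -mulrA; have -> : w * B + h * A + 2 ^+ k * (h ^+ 2 + t) * (w * B) =
    w * (B + h * (\sum_(e in live V I) #|e :&: V|%:R * z ^+ #|e :&: V|)
         + 2 ^+ k * (h ^+ 2 + t) * B) by rewrite /A; ring.
  rewrite ler_pM2l // /B /B' !mulr_sumr -!big_split /=.
  apply: ler_sum => e eL; rewrite exprMn.
  have jk : (#|e :&: V| <= k)%N.
    apply: leq_trans (subset_leq_card (subsetIl _ _)) (hk e _).
    by move: eL; rewrite inE => /andP[].
  have := exprD1_le_pow2 (ltW h0) h1 t0 jk.
  have : 0 <= z ^+ #|e :&: V| by apply: exprn_ge0; apply: ltW.
  move: (z ^+ _) ((1 + h) ^+ _) (2 ^+ k) (#|e :&: V|%:R) => a b c d a0 le1.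
  by have := ler_wpM2l a0 le1; lra.
move=> hlt; have K0 : 0 <= 2 ^+ k :> R by apply: exprn_ge0.
have n0 : 0 <= #|V|%:R :> R by [].
rewrite -(mulr_natr z); move: n0 hlt S1; move: #|V|%:R => n n0 hlt S1.
(* The second-order error is thus of order [h * w]; dividing by [h] at the end leaves the factor [w]
   in the slack bound. *)
have e1 : h ^+ 2 + t <= 3 * h * w.
  have : h * h <= h * w by apply: ler_wpM2l => //; apply: ltW.
  by rewrite expr2; lra.
have zn : 0 <= z * n by apply: mulr_ge0 => //; apply: ltW.
have wB0 : 0 <= w * B.
  apply: mulr_ge0; first exact: ltW.
  by apply: sumr_ge0 => e _; apply: exprn_ge0; apply: ltW.
have e2 : 2 ^+ k * (h ^+ 2 + t) * (w * B) <= 2 ^+ k * (3 * h * w) * (z * n).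
  apply: ler_pM => //; first by rewrite mulr_ge0 // addr_ge0 // sqr_ge0.
    exact: ler_wpM2l.
  exact: le_trans BA S1.
rewrite -(ler_pM2l h0); move: hlt B'le e2.
clearbody A B B'; move: (2 ^+ k) => K; clear => hlt B'le e2.
have : h * z * n < h * A + K * (3 * h * w) * (z * n) by lra.
lra.
Qed.

Lemma wdeg_ge0 w z V I u : 0 <= w -> 0 <= z -> 0 <= wdeg w z V I u.
Proof. by move=> w0 z0; apply: mulr_ge0 => //; apply: sumr_ge0 => e _; apply: exprn_ge0. Qed.

(** The weight is discretised as [w = N / i]. Deleting a vertex, choosing one, or passing from [i]
    to [i - 1] with [z] multiplied by [1 + 1 / N] all decrease [#|V| + i]. The bound on [z] keeps it
    at most 1 through all remaining parameter changes. Only a choice lowers the potential, by at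
    most the constant on the right. *)
Lemma exists_large_independent (k N : nat) : (0 < N)%N ->
  (forall e, e \in H -> #|e| <= k)%N ->
  forall i V I z, (N <= i <= N * N)%N -> 0 < z ->
  z * (1 + N%:R^-1) ^+ (i - N) <= 1 -> valid V I ->
  exists2 J : {set T}, (J \subset V) && independent H (I :|: J) &
    pot (N%:R / i%:R) z V I <= (2 + 3 * 2 ^+ k) * #|J|%:R.
Proof.
move=> N0 hk i V; move: {2}(#|V| + i)%N (leqnn (#|V| + i)%N) => m.
elim: m i V => [|m IH] i V.
  by rewrite leqn0 addn_eq0 => /andP[_ /eqP->] I z /andP[]; rewrite leqNgt N0.
move=> szm I z iN z0 zle vVI; have [dVI val] := vVI.
have NR : 0 < N%:R :> R by rewrite ltr0n.
have iR : 0 < i%:R :> R by rewrite ltr0n; case/andP: iN => /(leq_trans N0).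
have w0 : 0 < N%:R / i%:R :> R by apply: divr_gt0.
have K0 : 1 <= 2 ^+ k :> R by apply: exprn_ege1; lra.
have z1 : z <= 1.
  apply: le_trans zle; rewrite ler_peMr //; first exact: ltW.
  by apply: exprn_ege1; rewrite lerDl invr_ge0 ltW.
have [V0|Vn0] := eqVneq V set0.
  exists set0; first rewrite sub0set setU0 /=.
    apply/forall_inP => e eH; apply/negP => eI.
    by have := val e; rewrite inE eH V0 setI0 cards0 set0U eI => /(_ isT).
  rewrite cards0 mulr0 /pot V0 cards0 mulr0 sub0r oppr_le0.
  by apply: mulr_ge0; [apply: ltW|apply: sumr_ge0 => e _; apply: exprn_ge0; apply: ltW].
set w := N%:R / i%:R in w0 *.
have [hdeg|] := boolP [forall u in V, wdeg w z V I u <= z]; last first.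
  rewrite negb_forall_in => /exists_inP[u uV]; rewrite -ltNge => ud.
  have szu : (#|V :\ u| + i <= m)%N by move: szm; rewrite (cardsD1 u V) uV add1n addSn ltnS.
  have [J /andP[JV Ji] Jle] := IH _ _ szu I z iN z0 zle (valid_delete vVI uV).
  exists J; first by rewrite Ji (subset_trans JV) // subsetDl.
  by apply: le_trans Jle; rewrite pot_delete // -/w; lra.
move/forall_inP: hdeg => hdeg.
suff hsl : \sum_(u in V) (z - wdeg w z V I u) <= 3 * 2 ^+ k * w * z * #|V|%:R
    \/ exists2 J : {set T}, (J \subset V) && independent H (I :|: J) &
        pot w z V I <= (2 + 3 * 2 ^+ k) * #|J|%:R.
  case: hsl => // hsl.
  have C0 : 0 <= 3 * 2 ^+ k :> R by lra.
  have [v vV vle] := exists_good_step w0 z0 z1 C0 vVI Vn0 hdeg hsl.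
  set V' := V :\: _ in vle; set I' := v |: I in vle.
  have sub : V' \subset V :\ v.
    apply/subsetP => x; rewrite /V' in_setD in_setU1 in_setD1 negb_or.
    by move=> /andP[/andP[-> _] ->].
  have szv : (#|V'| + i <= m)%N.
    move: szm; rewrite (cardsD1 v V) vV add1n addSn ltnS.
    by apply: leq_trans; rewrite leq_add2r subset_leq_card.
  have [J /andP[JV Ji] Jle] := IH _ _ szv I' z iN z0 zle (valid_step vVI vV).
  have vJ : v \notin J.
    by apply/negP => /(subsetP JV)/(subsetP sub); rewrite in_setD1 eqxx.
  exists (v |: J).
    apply/andP; split; last by rewrite setUCA setUA.
    apply/subsetP => x; rewrite in_setU1 => /orP[/eqP->//|].
    by move=> /(subsetP JV)/(subsetP sub); rewrite in_setD1 => /andP[].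
  rewrite cardsU1 vJ add1n -[#|J|.+1%:R]natr1 mulrDr mulr1 -lerBlDr.
  exact: le_trans vle Jle.
(* At the end of the range [w = 1], and the slack bound is trivial since each slack is at most
   [z]. *)
have [iN'|Ni] := leqP i N.
  left; have -> : w = 1.
    have -> : w = N%:R / N%:R by congr (_ / _%:R); apply/anti_leq; rewrite iN'; case/andP: iN.
    by rewrite divff // gt_eqF.
  rewrite mulr1; apply: (@le_trans _ _ (\sum_(u in V) z)).
    by apply: ler_sum => u _; rewrite gerBl; apply: wdeg_ge0 => //; apply: ltW.
  rewrite sumr_const -(mulr_natr z); apply: ler_wpM2r => //.
  by rewrite ler_peMl //; lra.
(* From here on [i] denotes the predecessor, and [w = N / i.+1]. *)
case: i iN szm zle iR @w w0 hdeg Ni => [//|i] iN szm zle iR w w0 hdeg Ni.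
have i0 : 0 < i%:R :> R by rewrite ltr0n; apply: leq_trans N0 _.
have ew : w * (1 + i%:R^-1) = N%:R / i%:R.
  by rewrite /w -natr1; field; rewrite gt_eqF //= natr1 pnatr_eq0.
have [hle|hlt] := lerP (pot w z V I) (pot (w * (1 + i%:R^-1)) (z * (1 + N%:R^-1)) V I).
  right; have szi : (#|V| + i <= m)%N by move: szm; rewrite addnS ltnS.
  have iN2 : (N <= i <= N * N)%N by rewrite -ltnS Ni ltnW //; case/andP: iN.
  have z0' : 0 < z * (1 + N%:R^-1) by apply: mulr_gt0 => //; rewrite addr_gt0 ?invr_gt0.
  have zle' : z * (1 + N%:R^-1) * (1 + N%:R^-1) ^+ (i - N) <= 1.
    by rewrite -mulrA -exprS -subSn.
  have [J Ji Jle] := IH _ _ szi I _ iN2 z0' zle' vVI.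
  by exists J => //; apply: le_trans Jle; rewrite -ew.
(* With [h = 1 / N] and [t = 1 / i], the condition [h <= w] reads [i.+1 <= N * N], which fixes the
   range of the index; [t <= 2 * h * w] reads [i.+1 <= 2 * i]. *)
left; apply: (slack_le w0 z0 _ _ _ _ _ vVI hk hdeg hlt); rewrite ?invr_gt0 ?invr_ge0 //.
- by rewrite invf_le1 // ler1n.
- by rewrite /w ler_pdivlMr // mulrC ler_pdivrMr // -natrM ler_nat; case/andP: iN.
- have -> : 2 * N%:R^-1 * w = 2 / i.+1%:R
    by rewrite /w mulrA -[2 * _ * N%:R]mulrA mulVf ?gt_eqF // mulr1.
  by rewrite ler_pdivlMr // mulrC ler_pdivrMr // -natrM ler_nat; move: Ni N0; clear; lia.
Qed.

End Greedy.

(** * Random sampling and deletion *)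

Lemma leq_card_bigcup (I T : finType) (A : {set I}) (F : I -> {set T}) :
  (#|\bigcup_(i in A) F i| <= \sum_(i in A) #|F i|)%N.
Proof.
apply: (big_ind2 (fun (B : {set T}) n => #|B| <= n)%N) => //; first by rewrite cards0.
by move=> B m B' n Bm Bn; apply: leq_trans (leq_add Bm Bn); rewrite cardsU leq_subr.
Qed.

Section Sampling.
Variables (T : finType) (R : realFieldType) (q : R).
Hypotheses (q0 : 0 <= q) (q1 : q <= 1).
Implicit Types (A X Y : {set T}).

Definition bernoulli_weight X : R := \prod_(v : T) (if v \in X then q else 1 - q).

Lemma bernoulli_weight_ge0 X : 0 <= bernoulli_weight X.
Proof. by apply: prodr_ge0 => v _; case: ifP => _ //; rewrite subr_ge0. Qed.

(** Expand a product over vertices in which the option of leaving out a vertex of [A] has weight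
    0. *)
Lemma sum_bernoulli_weight_sup A :
  \sum_(X : {set T} | A \subset X) bernoulli_weight X = q ^+ #|A|.
Proof.
have <- : \prod_(v : T) (q + (if v \in A then 0 else 1 - q)) = q ^+ #|A|.
  rewrite -prodr_const [RHS]big_mkcond /=; apply: eq_bigr => v _.
  by case: ifP => _; [rewrite addr0|rewrite addrC subrK].
rewrite bigA_distr big_mkcond /=; apply: eq_bigr => X _; case: ifPn => [/subsetP AX|].
  apply: eq_bigr => v _; case: ifPn => // vX; case: ifPn => // vA.
  by rewrite (AX v vA) in vX.
by case/subsetPn => v vA vX; rewrite (bigD1 v) //= (negbTE vX) vA mul0r.
Qed.

Lemma bernoulli_mean_attained (f : {set T} -> R) :
  exists X : {set T}, \sum_(X : {set T}) bernoulli_weight X * f X <= f X.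
Proof.
set E := \sum_(X : {set T}) _; apply/existsP; apply: contraT; rewrite negb_exists => /forallP fE.
have S1 : \sum_(X : {set T}) bernoulli_weight X = 1.
  rewrite -[RHS](expr0 q) -(cards0 T) -sum_bernoulli_weight_sup.
  by apply: eq_bigl => X; rewrite sub0set.
have lt0 X : 0 < E - f X by rewrite subr_gt0 ltNge fE.
have S0 : \sum_(X : {set T}) bernoulli_weight X * (E - f X) = 0.
  under eq_bigr => X _ do rewrite mulrBr.
  by rewrite sumrB -mulr_suml S1 mul1r subrr.
(* Single weights may vanish when [q] is 0 or 1; the contradiction is that all of them would. *)
have w0 X : bernoulli_weight X = 0.
  have := psumr_eq0P (fun Y _ => mulr_ge0 (bernoulli_weight_ge0 Y) (ltW (lt0 Y))) S0.
  by move=> /(_ X isT)/eqP; rewrite mulf_eq0 (gt_eqF (lt0 X)) orbF => /eqP.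
by move: S1; under eq_bigr => X _ do rewrite w0; rewrite big1 // => /esym/eqP; rewrite oner_eq0.
Qed.

Lemma sum_bernoulli_weight_count (K : finType) (P : pred K) (U : K -> {set T}) :
  \sum_(X : {set T}) bernoulli_weight X * #|[set i | P i && (U i \subset X)]|%:R
    = \sum_(i | P i) q ^+ #|U i|.
Proof.
transitivity (\sum_(X : {set T}) \sum_(i | P i && (U i \subset X)) bernoulli_weight X).
  apply: eq_bigr => X _; rewrite mulr_natr -sumr_const.
  by apply: eq_bigl => i; rewrite inE.
rewrite (exchange_big_dep P) /=; last by move=> X i _ /andP[].
apply: eq_bigr => i Pi; rewrite -sum_bernoulli_weight_sup.
by apply: eq_bigl => X; rewrite Pi.
Qed.

(** Take a sample at least as good as the mean and remove one vertex from each bad set [U i] inside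
    it. Each removal costs at most [a], and it can only decrease the number of edges. *)
Lemma alteration (K : finType) (P : pred K) (U : K -> {set T}) (H : {set {set T}})
    (a b : R) : 0 <= a -> 0 <= b -> (forall i, P i -> U i != set0) ->
  exists2 Y : {set T}, (forall i, P i -> ~~ (U i \subset Y)) &
    a * q * #|T|%:R - a * \sum_(i | P i) q ^+ #|U i| - b * \sum_(e in H) q ^+ #|e|
    <= a * #|Y|%:R - b * #|[set e in H | e \subset Y]|%:R.
Proof.
move=> a0 b0 U0.
have [X] := bernoulli_mean_attained (fun X => a * #|X|%:R
  - a * #|[set i | P i && (U i \subset X)]|%:R - b * #|[set e in H | e \subset X]|%:R).
have -> : \sum_(X : {set T}) bernoulli_weight X * (a * #|X|%:R
      - a * #|[set i | P i && (U i \subset X)]|%:R - b * #|[set e in H | e \subset X]|%:R)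
    = a * q * #|T|%:R - a * \sum_(i | P i) q ^+ #|U i| - b * \sum_(e in H) q ^+ #|e|.
  rewrite -sum_bernoulli_weight_count -(sum_bernoulli_weight_count (mem H) id).
  rewrite -[a * q * _]mulrA.
  have -> : q * #|T|%:R =
      \sum_(X : {set T}) bernoulli_weight X * #|[set v : T | true && ([set v] \subset X)]|%:R.
    rewrite (sum_bernoulli_weight_count xpredT (fun v : T => [set v])).
    under eq_bigr => v _ do rewrite cards1 expr1.
    by rewrite sumr_const mulr_natr.
  rewrite !mulr_sumr -!sumrB; apply: eq_bigr => Y _.
  have -> : [set v | true && ([set v] \subset Y)] = Y by apply/setP => v; rewrite inE sub1set.
  ring.
pose B := [set i | P i && (U i \subset X)]; rewrite -/B.
pose Z := \bigcup_(i in B) [set x | [pick y in U i] == Some x].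
have ZB : (#|Z| <= #|B|)%N.
  rewrite -[#|B|]sum1_card.
  apply: (@leq_trans (\sum_(i in B) #|[set x | [pick y in U i] == Some x]|)).
    exact: leq_card_bigcup.
  apply: leq_sum => i _; case: pickP => [y yU|_]; last first.
    by rewrite (_ : [set x | _] = set0) ?cards0 //; apply/setP => x; rewrite !inE.
  rewrite (_ : [set x | _] = [set y]) ?cards1 //.
  by apply/setP => x; rewrite !inE eq_sym.
move=> le; exists (X :\: Z) => [i Pi|].
  apply/negP => /subsetP sub.
  have iB : i \in B.
    by rewrite inE Pi; apply/subsetP => x /sub; rewrite inE => /andP[].
  have /set0Pn[y yU] := U0 i Pi.
  have [y' y'U y'E] : exists2 y', y' \in U i & [pick y in U i] = Some y'.
    by case: pickP => [y' y'U|/(_ y)]; [exists y'|rewrite yU].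
  have := sub y' y'U; rewrite inE => /andP[/negP y'Z _]; case: y'Z.
  by apply/bigcupP; exists i => //; rewrite inE y'E.
apply: le_trans le _.
have cX : #|X|%:R - #|B|%:R <= #|X :\: Z|%:R :> R.
  rewrite lerBlDr -natrD ler_nat -(cardsID Z X) addnC leq_add2l.
  exact: leq_trans (subset_leq_card (subsetIr _ _)) ZB.
have cE : #|[set e in H | e \subset X :\: Z]|%:R <= #|[set e in H | e \subset X]|%:R :> R.
  rewrite ler_nat; apply/subset_leq_card/subsetP => e; rewrite !inE => /andP[-> /=].
  by move=> eX; apply: subset_trans eX (subsetDl _ _).
by have := ler_wpM2l a0 cX; have := ler_wpM2l b0 cE; lra.
Qed.

End Sampling.

(** * Overlapping pairs and triangles in systems *)

Section Counting.
Variables (T : finType) (k l lam : nat) (H : {set {set T}}).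
Hypotheses (sysH : is_system k l lam H) (lk : (l < k)%N).
Implicit Types (A e f g : {set T}).

Lemma system_card e : e \in H -> #|e| = k.
Proof. by case/andP: sysH => /forall_inP hk _ /hk/eqP. Qed.

(** Each missing vertex is added to [A] in at most [#|T|] ways, until [A] contains an [l]-set. *)
Lemma codegree_le (d : nat) A : (l <= #|A| + d)%N ->
  (#|[set e in H | A \subset e]| <= lam * #|T| ^ d)%N.
Proof.
elim: d A => [|d IH] A.
  rewrite addn0 expn0 muln1 => lA.
  have [L /andP[LA /eqP Ll]] : exists L : {set T}, (L \subset A) && (#|L| == l).
    exists [set x in take l (enum A)]; apply/andP; split.
      by apply/subsetP => x; rewrite inE => /mem_take; rewrite mem_enum.
    by rewrite cardsE (card_uniqP (take_uniq _ (enum_uniq _))) size_takel // -cardE.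
  case/andP: sysH => _ /forall_inP/(_ L); rewrite Ll eqxx => /(_ isT); apply: leq_trans.
  apply/subset_leq_card/subsetP => e; rewrite !inE => /andP[-> /=].
  exact: subset_trans.
(* If [A] already has [k] vertices, an edge need not offer a new one; but then [l <= #|A|], and the
   induction hypothesis applies to [A] itself. *)
move=> lA; have [kA|Ak] := leqP k #|A|.
  have T0 : (0 < #|T|)%N.
    by apply: leq_trans (max_card (mem A)); apply: leq_trans kA; apply: leq_ltn_trans lk.
  apply: leq_trans (_ : lam * #|T| ^ d <= _)%N; last by rewrite leq_mul // leq_pexp2l.
  by apply: IH; rewrite (leq_trans (ltnW lk)) // (leq_trans kA) // leq_addr.
have sub : [set e in H | A \subset e] \subset
    \bigcup_(v in ~: A) [set e in H | v |: A \subset e].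
  apply/subsetP => e; rewrite inE => /andP[eH Ae].
  have /properP[_ [v ve vA]] : A \proper e by rewrite properEcard Ae (system_card eH).
  apply/bigcupP; exists v; rewrite ?inE // eH /=; apply/subsetP => x.
  by rewrite in_setU1 => /orP[/eqP->//|/(subsetP Ae)].
apply: leq_trans (subset_leq_card sub) _.
apply: (@leq_trans (\sum_(v in ~: A) #|[set e in H | v |: A \subset e]|)).
  exact: leq_card_bigcup.
apply: (@leq_trans (\sum_(v in ~: A) lam * #|T| ^ d)).
  apply: leq_sum => v; rewrite inE => vA; apply: IH.
  by rewrite cardsU1 vA add1n addSnnS.
by rewrite sum_nat_const expnS mulnCA leq_mul2l leq_mul2r max_card !orbT.
Qed.

Lemma system_size_le : (#|H| <= lam * #|T| ^ l)%N.
Proof.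
have := @codegree_le l set0; rewrite cards0 add0n => /(_ (leqnn _)).
rewrite (_ : [set e in H | _] = H) //.
by apply/setP => e; rewrite inE sub0set andbT.
Qed.

Definition overlapping (p : {set T} * {set T}) : bool :=
  [&& p.1 \in H, p.2 \in H, p.1 != p.2 & (2 <= #|p.1 :&: p.2|)%N].

(** Fix [e] and sort the edges [f] by [e :&: f]: there are at most [2 ^ k] intersections, each
    contributing a codegree times [q ^+ (2 * k - j)]. Truncated subtraction makes the codegree bound
    [lam] for [j >= l]. *)
Lemma sum_overlapping_le (R : realFieldType) (q B : R) : 0 <= q ->
  (forall j, (2 <= j < k)%N -> (lam * #|T| ^ (l - j))%:R * q ^+ (2 * k - j) <= B) ->
  0 <= B ->
  \sum_(p | overlapping p) q ^+ #|p.1 :|: p.2| <= #|H|%:R * (2 ^+ k * B).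
Proof.
move=> q0 hB B0.
rewrite (eq_bigl (fun p => (p.1 \in H) && overlapping p)); last first.
  by move=> p; rewrite /overlapping; case: (p.1 \in H).
rewrite -(pair_big_dep (mem H) (fun e f => overlapping (e, f))
   (fun e f => q ^+ #|e :|: f|)) /= mulr_natl -sumr_const.
apply: ler_sum => e eH.
rewrite (partition_big (fun f => e :&: f)
  (fun A => (A \in powerset e) && (2 <= #|A| < k)%N)) /=; last first.
  move=> f /and4P[_ fH ef ef2]; rewrite inE subsetIl ef2 /= -(system_card eH).
  apply: proper_card; rewrite properEneq subsetIl andbT; apply: contra ef => /eqP ef.
  have sub : e \subset f by rewrite -ef subsetIr.
  by rewrite eqEcard sub (system_card eH) (system_card fH) /=.
apply: (@le_trans _ _ (\sum_(A in powerset e) B)); last first.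
  by rewrite sumr_const card_powerset (system_card eH) -(mulr_natl B) natrX.
rewrite big_mkcondr /=; apply: ler_sum => A; rewrite inE => Ae.
case: ifP => // /hB; apply: le_trans.
apply: (@le_trans _ _ (\sum_(f in [set f in H | A \subset f]) q ^+ (2 * k - #|A|))).
  rewrite [X in _ <= X](bigID (fun f => overlapping (e, f) && (e :&: f == A))) /=.
  rewrite -[X in X <= _]addr0; apply: lerD; last by apply: sumr_ge0 => f _; apply: exprn_ge0.
  rewrite le_eqVlt; apply/orP; left; apply/eqP; apply: eq_big => [f|f].
    rewrite inE; apply/idP/andP => [/andP[ov /eqP efA]|[] //].
    rewrite -efA subsetIr ov eqxx; case/and4P: ov => /= _ ->.
    by [].
  move=> /andP[/and4P[_ /= fH _ _] /eqP <-].
  by rewrite cardsU (system_card eH) (system_card fH) mul2n addnn.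
rewrite sumr_const -(mulr_natl (q ^+ _)); apply: ler_wpM2r; first exact: exprn_ge0.
by rewrite ler_nat; apply: codegree_le; lia.
Qed.

(** Larger intersections are left to [overlapping]; without them the union has at least [3 * k - 3]
    vertices. *)
Definition loose_triangle (p : {set T} * {set T} * {set T}) : bool :=
  let: (e, f, g) := p in
  [&& e \in H, f \in H, g \in H, (#|e :&: f| <= 1)%N, (#|f :&: g| <= 1)%N,
      (#|e :&: g| <= 1)%N &
      [exists a in e :&: f, exists b in f :&: g, exists c in e :&: g,
        [&& a != b, b != c & a != c]]].

Lemma card_fibers (X Y : finType) (A : {set X * Y}) (B : {set X}) (d : nat) :
  (forall p, p \in A -> p.1 \in B) ->
  (forall x, x \in B -> #|[set y | (x, y) \in A]| <= d)%N -> (#|A| <= #|B| * d)%N.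
Proof.
move=> AB hd; rewrite -sum1_card (eq_bigl (fun p => (p.1 \in B) && ((p.1, p.2) \in A))); last first.
  by move=> [x y] /=; apply/idP/andP => [xyA|[]//]; split=> //; apply: AB xyA.
rewrite -(pair_big_dep (mem B) (fun x y => (x, y) \in A) (fun _ _ => 1%N)) /= -sum_nat_const.
apply: leq_sum => x xB; apply: leq_trans (hd x xB); rewrite -sum1_card.
by rewrite (eq_bigl (mem [set y | (x, y) \in A])) // => y; rewrite !inE.
Qed.

(** The factors count, in order, the choices of [e], of [a] and [c] in [e], of [f] through [a], of
    [b] in [f], and of [g] through [b] and [c]. *)
Lemma card_loose_triangle_le :
  (#|[set p | loose_triangle p]| <=
     #|H| * k * k * (lam * #|T| ^ (l - 1)) * k * (lam * #|T| ^ (l - 2)))%N.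
Proof.
pose Q2 := [set p : {set T} * T | (p.1 \in H) && (p.2 \in p.1)].
pose Q3 := [set p : {set T} * T * T | (p.1 \in Q2) && (p.2 \in p.1.1)].
pose Q4 := [set p : {set T} * T * T * {set T} |
  (p.1 \in Q3) && (p.2 \in [set f in H | [set p.1.1.2] \subset f])].
pose Q5 := [set p : {set T} * T * T * {set T} * T | (p.1 \in Q4) && (p.2 \in p.1.2)].
pose Q6 := [set p : {set T} * T * T * {set T} * T * {set T} |
  [&& p.1 \in Q5, p.1.2 != p.1.1.1.2 &
      p.2 \in [set g in H | [set p.1.2; p.1.1.1.2] \subset g]]].
have c2 : (#|Q2| <= #|H| * k)%N.
  apply: card_fibers => [p|e eH]; first by rewrite inE => /andP[].
  rewrite -(system_card eH); apply/subset_leq_card/subsetP => a.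
  by rewrite !inE => /andP[].
have c3 : (#|Q3| <= #|Q2| * k)%N.
  apply: card_fibers => [p|[e a]]; first by rewrite inE => /andP[].
  rewrite inE => /andP[/= eH _]; rewrite -(system_card eH).
  by apply/subset_leq_card/subsetP => c; rewrite !inE => /andP[].
have c4 : (#|Q4| <= #|Q3| * (lam * #|T| ^ (l - 1)))%N.
  apply: card_fibers => [p|[[e a] c] _]; first by rewrite inE => /andP[].
  apply: leq_trans (_ : #|[set f in H | [set a] \subset f]| <= _)%N.
    apply/subset_leq_card/subsetP => f; rewrite !in_set.
    by case/andP.
  by apply: codegree_le; rewrite cards1; lia.
have c5 : (#|Q5| <= #|Q4| * k)%N.
  apply: card_fibers => [p|[p f]]; first by rewrite inE => /andP[].
  rewrite inE => /andP[_ /=]; rewrite inE => /andP[fH _]; rewrite -(system_card fH).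
  by apply/subset_leq_card/subsetP => b; rewrite !in_set => /andP[].
have c6 : (#|Q6| <= #|Q5| * (lam * #|T| ^ (l - 2)))%N.
  apply: card_fibers => [p|[[[[e a] c] f] b] _]; first by rewrite inE => /and3P[].
  have [bc|bc] := eqVneq b c.
    rewrite (_ : [set g | _] = set0) ?cards0 //; apply/setP => g.
    by rewrite in_set in_set /= bc eqxx andbF in_set0.
  apply: leq_trans (_ : #|[set g in H | [set b; c] \subset g]| <= _)%N.
    apply/subset_leq_card/subsetP => g; rewrite !in_set.
    by case/and3P.
  by apply: codegree_le; rewrite cards2 bc; lia.
have c1 : (#|[set p | loose_triangle p]| <= #|Q6|)%N.
  pose pr (p : {set T} * T * T * {set T} * T * {set T}) := (p.1.1.1.1.1, p.1.1.2, p.2).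
  apply: leq_trans (leq_imset_card pr Q6); apply/subset_leq_card/subsetP => [[[e f] g]].
  rewrite inE => /and5P[eH fH gH _ /and3P[_ _]].
  case/exists_inP => a /setIP[ae af] /exists_inP[b /setIP[bf bg]].
  case/exists_inP => c /setIP[ce cg] /and3P[ab bc ac].
  apply/imsetP; exists (e, a, c, f, b, g) => //.
  rewrite in_set /= bc in_set /= in_set /= in_set /= in_set /= eH ae ce bf.
  by rewrite !in_set fH gH sub1set af subUset !sub1set bg cg.
apply: leq_trans c1 _; apply: leq_trans c6 _; rewrite leq_mul2r; apply/orP; right.
apply: leq_trans c5 _; rewrite leq_mul2r; apply/orP; right.
apply: leq_trans c4 _; rewrite leq_mul2r; apply/orP; right.
by apply: leq_trans c3 _; rewrite leq_mul2r; apply/orP; right.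
Qed.

Lemma card_loose_triangle_union e f g :
  loose_triangle (e, f, g) -> (3 * k - 3 <= #|e :|: f :|: g|)%N.
Proof.
case/and5P => eH fH gH ef /and3P[fg eg _].
have := cardsUI (e :|: f) g; have := cardsUI e f.
rewrite (system_card eH) (system_card fH) (system_card gH).
have : (#|(e :|: f) :&: g| <= 2)%N.
  by rewrite setIUl; have := cardsUI (e :&: g) (f :&: g); lia.
by lia.
Qed.

Lemma sum_loose_triangle_le (R : realFieldType) (q : R) : 0 <= q -> q <= 1 ->
  \sum_(p | loose_triangle p) q ^+ #|p.1.1 :|: p.1.2 :|: p.2| <=
    (#|H| * k * k * (lam * #|T| ^ (l - 1)) * k * (lam * #|T| ^ (l - 2)))%:R
    * q ^+ (3 * k - 3).
Proof.
move=> q0 q1.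
apply: (@le_trans _ _ (\sum_(p in [set p | loose_triangle p]) q ^+ (3 * k - 3))).
  rewrite [X in _ <= X](eq_bigl loose_triangle); last by move=> p; rewrite inE.
  apply: ler_sum => [[[e f] g]] /card_loose_triangle_union.
  exact: ler_wiXn2l.
rewrite sumr_const -(mulr_natl (q ^+ _)); apply: ler_wpM2r; first exact: exprn_ge0.
by rewrite ler_nat card_loose_triangle_le.
Qed.

End Counting.

(** * Choice of the parameters *)

Lemma system_alpha_ge (T : finType) (R : realFieldType) (k l lam N : nat)
    (H : {set {set T}}) (q z B : R) :
  is_system k l lam H -> (1 < l < k)%N -> 0 <= q -> q <= 1 -> 0 < z -> (0 < N)%N ->
  z * (1 + N%:R^-1) ^+ (N * N - N) <= 1 -> 0 <= B ->
  (forall j, (2 <= j < k)%N -> (lam * #|T| ^ (l - j))%:R * q ^+ (2 * k - j) <= B) ->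
  z * q * #|T|%:R - z * (#|H|%:R * (2 ^+ k * B))
    - z * ((#|H| * k * k * (lam * #|T| ^ (l - 1)) * k * (lam * #|T| ^ (l - 2)))%:R
           * q ^+ (3 * k - 3))
    - N%:R^-1 * z ^+ k * (#|H|%:R * q ^+ k)
  <= (2 + 3 * 2 ^+ k) * (alpha H)%:R.
Proof.
move=> sysH /andP[l1 lk] q0 q1 z0 N0 zN B0 hB.
(* A sum type lets one alteration destroy overlapping pairs and triangles together. *)
pose P (i : {set T} * {set T} + {set T} * {set T} * {set T}) :=
  match i with inl p => overlapping H p | inr p => loose_triangle H p end.
pose U (i : {set T} * {set T} + {set T} * {set T} * {set T}) :=
  match i with inl p => p.1 :|: p.2 | inr p => p.1.1 :|: p.1.2 :|: p.2 end.
have k0 : (0 < k)%N by lia.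
have en0 e (X : {set T}) : e \in H -> e \subset X -> X != set0.
  move=> eH eX; rewrite -card_gt0; apply: leq_trans (subset_leq_card eX).
  by rewrite (system_card sysH eH).
have U0 i : P i -> U i != set0.
  case: i => [[e f] /and4P[/= eH _ _ _]|[[e f] g] /= /andP[eH _]].
    exact: en0 eH (subsetUl _ _).
  by apply: en0 eH _; rewrite -setUA subsetUl.
have b0 : 0 <= N%:R^-1 * z ^+ k.
  by rewrite mulr_ge0 ?invr_ge0 // exprn_ge0 // ltW.
(* The weights [z] and [z ^+ k / N] turn the right-hand side into the potential of [(Y, set0)] at
   [w = 1 / N], that is, at index [N * N]. *)
have [Y YP] := alteration q0 q1 H (ltW z0) b0 U0.
rewrite big_sumType /=.
have ov := sum_overlapping_le sysH lk q0 hB B0.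
have lt := sum_loose_triangle_le sysH lk q0 q1.
have -> : \sum_(e in H) q ^+ #|e| = #|H|%:R * q ^+ k.
  by rewrite mulr_natl -sumr_const; apply: eq_bigr => e eH; rewrite (system_card sysH).
set H' := [set e in H | e \subset Y] => le.
have inH' e : e \in H' -> (e \in H) /\ (e \subset Y) by rewrite inE => /andP[].
have le1 e f : e \in H' -> f \in H' -> e != f -> (#|e :&: f| <= 1)%N.
  move=> /inH'[eH eY] /inH'[fH fY] ef; rewrite leqNgt; apply/negP => ef2.
  have := YP (inl (e, f)); rewrite /= /overlapping /= eH fH ef ef2 subUset eY fY.
  by move=> /(_ isT).
(* Surviving edges pairwise share at most one vertex, so any triangle among them would be loose. *)
have tri : triangle_free H'.
  move=> e f g a b c eH' fH' gH' ab bc ac ae af bf bg cg ce.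
  have [->|ef] := eqVneq e f; first by constructor 1.
  have [->|fg] := eqVneq f g; first by constructor 2.
  have [->|eg] := eqVneq e g; first by constructor 3.
  have := YP (inr (e, f, g)); rewrite /= (le1 e f) // (le1 f g) // (le1 e g) //.
  have [eH eY] := inH' e eH'; have [fH fY] := inH' f fH'; have [gH gY] := inH' g gH'.
  rewrite eH fH gH !subUset eY fY gY /=.
  have -> : [exists a in e :&: f, exists b in f :&: g, exists c in e :&: g,
        [&& a != b, b != c & a != c]].
    apply/exists_inP; exists a; rewrite ?inE ?ae //.
    apply/exists_inP; exists b; rewrite ?inE ?bf //.
    by apply/exists_inP; exists c; rewrite ?inE ?ce ?ab ?bc.
  by move=> /(_ isT).
have hk' e : e \in H' -> (#|e| <= k)%N by move=> /inH'[eH _]; rewrite (system_card sysH eH).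
have live' : live H' Y set0 = H'.
  by apply/setP => e; rewrite !inE setU0; case: (e \subset Y); rewrite ?andbT ?andbF.
have valid' : valid H' Y set0.
  split; first by rewrite disjoint_sym; apply/pred0P => x; rewrite !inE.
  move=> e; rewrite live' => /inH'[eH eY].
  by rewrite (setIidPl eY) (system_card sysH eH) (ltn_trans l1 lk).
have NN : (N <= N * N <= N * N)%N by rewrite leqnn leq_pmulr.
have [J /andP[JY Ji] Jle] := exists_large_independent tri N0 hk' NN z0 zN valid'.
have JH : independent H J.
  apply/forall_inP => e eH; apply/negP => eJ.
  move/forall_inP: Ji => /(_ e); rewrite inE eH (subset_trans eJ JY) set0U eJ.
  by move=> /(_ isT).
have Ja : (#|J| <= alpha H)%N by exact: (leq_bigmax_cond (F := fun S : {set T} => #|S|) _ JH).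
have K0 : 0 <= 2 + 3 * 2 ^+ k :> R.
  by rewrite addr_ge0 // mulr_ge0 // exprn_ge0.
apply: (@le_trans _ _ ((2 + 3 * 2 ^+ k) * #|J|%:R)); last by apply: ler_wpM2l; rewrite ?ler_nat.
apply: le_trans Jle; move: le; rewrite /pot live'.
have -> : \sum_(e in H') z ^+ #|e :&: Y| = #|H'|%:R * z ^+ k.
  rewrite mulr_natl -sumr_const; apply: eq_bigr => e /inH'[eH eY].
  by rewrite (setIidPl eY) (system_card sysH).
have -> : N%:R / (N * N)%:R = N%:R^-1 :> R.
  by rewrite natrM invfM mulrA divff ?mul1r // pnatr_eq0 -lt0n.
have := lerD (ler_wpM2l (ltW z0) ov) (ler_wpM2l (ltW z0) lt).
move: (_%:R * q ^+ (3 * k - 3)) (#|H|%:R * (2 ^+ k * B)) (#|H|%:R * q ^+ k).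
move: (\sum_(p | overlapping H p) _) (\sum_(p | loose_triangle H p) _) (#|H'|%:R).
move: (#|Y|%:R) (#|T|%:R) (z ^+ k) (N%:R^-1); clear => *; lra.
Qed.

(* [G] is the [(k-1)]-st power of the ratio between the sampling density [q] and
   the trivial density [D ^ (- 1 / (k-1))], where [D] bounds the degrees. *)
Lemma system_alpha_ge_density (T : finType) (R : realFieldType) (k l lam N : nat)
    (H : {set {set T}}) (q z D G K : R) :
  is_system k l lam H -> (1 < l < k)%N -> (0 < lam)%N -> (0 < #|T|)%N ->
  0 < q -> q <= 1 -> 0 < z -> (0 < N)%N ->
  z * (1 + N%:R^-1) ^+ (N * N - N) <= 1 ->
  D = lam%:R * #|T|%:R ^+ l.-1 -> q ^+ k.-1 * D = G -> 1 <= G ->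
  4 * 2 ^+ k <= K -> 4 * k%:R ^+ 3 <= K ->
  K * G ^+ 3 <= q * #|T|%:R -> K * G * lam%:R * q <= 1 ->
  (z * q) ^+ k.-1 * D <= N%:R / 4 ->
  z * q * #|T|%:R / 4 <= (2 + 3 * 2 ^+ k) * (alpha H)%:R.
Proof.
move=> sysH lk lam0 T0 q0 q1 z0 N0 zN DE GE G1 K2 K3 KG3 Kq zqD.
have [l1 lk'] := andP lk.
have kE : k = k.-1.+1 by rewrite prednK // (leq_trans _ lk').
set x : R := #|T|%:R in DE KG3 *.
have x0 : 0 < x by rewrite ltr0n.
have la0 : 0 < lam%:R :> R by rewrite ltr0n.
have D0 : 0 < D by rewrite DE mulr_gt0 // exprn_gt0.
have G0 : 0 < G by apply: lt_le_trans G1.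
have P2 : 0 < 2 ^+ k :> R by apply: exprn_gt0.
have K0 : 0 < K by apply: lt_le_trans K2; rewrite mulr_gt0.
have HD : #|H|%:R <= x * D.
  rewrite DE mulrCA -exprS prednK ?(ltnW l1) // -natrX -natrM ler_nat.
  exact: system_size_le sysH lk'.
(* With [#|H| <= x * D], this value makes the overlap term at most a quarter of the main term. *)
pose B := q / (4 * 2 ^+ k * D).
have B0 : 0 < B by rewrite divr_gt0 // !mulr_gt0.
have hB j : (2 <= j < k)%N -> (lam * #|T| ^ (l - j))%:R * q ^+ (2 * k - j) <= B.
  move=> /andP[j2 jk]; rewrite natrM natrX -/x /B ler_pdivlMr ?mulr_gt0 //.
  set L := lam%:R * x ^+ (l - j) * q ^+ (2 * k - j) * D.
  have L0 : 0 <= L by rewrite !mulr_ge0 ?exprn_ge0 // ltW.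
  suff KL : K * L <= q.
    apply: le_trans KL; rewrite (_ : _ * (4 * _ * _) = 4 * 2 ^+ k * L); last by rewrite /L; ring.
    exact: ler_wpM2r.
  (* For [j <= l], multiplying [L] by [(q * x) ^+ j.-1] gives [G ^+ 2 * q], and this factor is at
     least [K * G ^+ 2] because [j >= 2]. *)
  have [jl|lj] := leqP j l.
    have y1 : 1 <= q * x.
      apply: le_trans KG3; apply: (@le_trans _ _ (1 * 1)); first by rewrite mulr1.
      apply: ler_pM => //; last exact: exprn_ege1.
      by apply: le_trans K2; have : 1 <= 2 ^+ k :> R by [apply: exprn_ege1; lra]; lra.
    have LE : L * (q * x) ^+ j.-1 = G ^+ 2 * q.
      rewrite /L DE -GE DE exprMn.
      have -> : (2 * k - j = k.-1 + k.-1 + 1 - j.-1)%N by clear -l1 lk' j2 jk; lia.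
      have -> : (l.-1 = (l - j) + j.-1)%N by clear -jl j2; lia.
      have e1 : q ^+ (k.-1 + k.-1 + 1 - j.-1) * q ^+ j.-1 = q ^+ k.-1 * q ^+ k.-1 * q.
        by rewrite -exprD subnK ?exprD ?expr1 //; clear -jk j2; lia.
      set m := (_ - j.-1)%N in e1 *; rewrite exprD; move: e1.
      move: (q ^+ m) (q ^+ j.-1) (q ^+ k.-1) (x ^+ (l - j)) (x ^+ j.-1) => a b c d e e1.
      transitivity (a * b * (lam%:R * lam%:R * d * d * e * e)); first by ring.
      by rewrite e1; ring.
    have G2 : 0 < G ^+ 2 by apply: exprn_gt0.
    rewrite -(ler_pM2l G2) -LE (_ : _ * (K * L) = L * (K * G ^+ 2)); last by ring.
    apply: ler_wpM2l => //; apply: (@le_trans _ _ (q * x)).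
      apply: le_trans KG3; rewrite ler_pM2l // exprS ler_peMl // ltW //.
    rewrite -[X in X <= _]expr1; apply: ler_weXn2l => //; clear -j2; lia.
  (* For [j > l], [q] occurs to a power of at least 2: one factor is absorbed by [Kq], another one
     remains. *)
  have -> : K * L = K * G * lam%:R * q ^+ (k.+1 - j).
    rewrite /L (_ : (l - j = 0)%N) ?expr0 ?mulr1; last by clear -lj; lia.
    rewrite -GE (_ : (2 * k - j = k.-1 + (k.+1 - j))%N) ?exprD; last by clear -jk j2; lia.
    by ring.
  have -> : q ^+ (k.+1 - j) = q * q ^+ (k - j) by rewrite -exprS subSn // ltnW.
  have qj : q ^+ (k - j) <= q.
    rewrite -(prednK (_ : 0 < k - j)%N) ?subn_gt0 // exprS ler_piMr ?(ltW q0) //.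
    by apply: exprn_ile1 => //; apply: ltW.
  have KGl : 0 <= K * G * lam%:R * q by rewrite !mulr_ge0 // ltW.
  by have := ler_wpM2l KGl qj; have := ler_wpM2r (ltW q0) Kq; lra.
have := system_alpha_ge sysH lk (ltW q0) q1 z0 N0 zN (ltW B0) hB.
apply: le_trans.
(* Each of the three error terms is at most a quarter of [z * q * x], so a quarter is left. *)
have zqx0 : 0 < z * q * x by rewrite !mulr_gt0.
have t1 : z * (#|H|%:R * (2 ^+ k * B)) <= z * q * x / 4.
  apply: (@le_trans _ _ (z * (x * D * (2 ^+ k * B)))).
    by rewrite ler_pM2l // ler_pM2r // mulr_gt0.
  by rewrite /B le_eqVlt; apply/orP; left; apply/eqP; field; rewrite !gt_eqF.
have t2 : z * ((#|H| * k * k * (lam * #|T| ^ (l - 1)) * k * (lam * #|T| ^ (l - 2)))%:R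
           * q ^+ (3 * k - 3)) <= z * q * x / 4.
  rewrite -!mulrA ler_pM2l // mulrA.
  apply: (@le_trans _ _ (k%:R ^+ 3 * G ^+ 3)); last first.
    have : 4 * k%:R ^+ 3 * G ^+ 3 <= K * G ^+ 3 by rewrite ler_pM2r // exprn_gt0.
    by rewrite mulrA; lra.
  rewrite !natrM !natrX -/x subn1 -GE.
  have -> : (3 * k - 3 = k.-1 * 3)%N by clear; lia.
  rewrite exprMn -exprM; set Q := q ^+ _.
  have Q0 : 0 < Q by apply: exprn_gt0.
  have xl : x ^+ l.-1 = x ^+ (l - 2) * x by rewrite -exprSr; congr (_ ^+ _); clear -l1; lia.
  have -> : k%:R ^+ 3 * (Q * D ^+ 3) =
    x * D * (k%:R ^+ 3 * D * (lam%:R * x ^+ (l - 2)) * Q).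
    by rewrite DE xl; ring.
  rewrite (_ : _ * Q = #|H|%:R * (k%:R ^+ 3 * D * (lam%:R * x ^+ (l - 2)) * Q)); last first.
    by rewrite DE; ring.
  apply: ler_wpM2r => //.
  by rewrite !mulr_ge0 ?exprn_ge0 // ltW.
have t3 : N%:R^-1 * z ^+ k * (#|H|%:R * q ^+ k) <= z * q * x / 4.
  have NR : 0 < N%:R :> R by rewrite ltr0n.
  apply: (@le_trans _ _ (N%:R^-1 * z ^+ k * (x * D * q ^+ k))).
    by rewrite ler_pM2l ?mulr_gt0 ?invr_gt0 ?exprn_gt0 // ler_pM2r // exprn_gt0.
  rewrite [X in X <= _](_ : _ = z * q * x * (N%:R^-1 * ((z * q) ^+ k.-1 * D))); last first.
    have e (y : R) : y ^+ k = y * y ^+ k.-1 by rewrite -exprS -kE.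
    by rewrite !e exprMn; ring.
  by rewrite ler_pM2l // mulrC ler_pdivrMr // [X in _ <= X]mulrC.
lra.
Qed.

(* Real powers, logarithms and the final constants *)
From mathcomp Require Import all_classical all_reals all_analysis.

Lemma exprn_root_powR (R : realType) (r : nat) (a : R) : (0 < r)%N -> 0 <= a ->
  (a `^ (1 / r%:R)) ^+ r = a.
Proof.
move=> r0 a0; rewrite -powR_mulrn ?powR_ge0 // -powRrM mul1r mulVf ?powRr1 //.
by rewrite pnatr_eq0 -lt0n.
Qed.

(** This bounds the total growth of [z] over all parameter changes of the greedy selection. *)
Lemma expr1Dinv_le_expR (R : realType) (N m : nat) : (0 < N)%N -> (m <= N * N)%N ->
  (1 + N%:R^-1 : R) ^+ m <= expR N%:R.
Proof.
move=> N0 mN; have NR : 0 < N%:R :> R by rewrite ltr0n.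
have b1 : 1 <= 1 + N%:R^-1 :> R by rewrite lerDl invr_ge0 ltW.
apply: (@le_trans _ _ ((1 + N%:R^-1) ^+ (N * N))); first exact: ler_weXn2l.
apply: (@le_trans _ _ (expR N%:R^-1 ^+ (N * N))).
  by apply: lerXn2r; rewrite ?nnegrE ?expR_ge0 ?expR_ge1Dx // (le_trans _ b1).
by rewrite -expRM_natl natrM mulfK // gt_eqF.
Qed.

(** The first bound holds since [(l - 1) / (k - 2) <= 1 <= k - l]; it will give
    [K * G ^+ 3 <= q * n]. The second comes from raising the hypothesis to the power [k - 2 >= 1];
    it will give [K * G * lam * q <= 1]. *)
Lemma system_codegree_powR (R : realType) (k l lam n : nat) (delta : R) :
  (1 < l < k)%N -> (0 < n)%N -> 0 <= delta ->
  lam%:R <= n%:R `^ ((l%:R - 1) / (k%:R - 2) - delta) ->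
  lam%:R * n%:R `^ delta <= n%:R ^+ (k - l) :> R /\
  lam%:R ^+ (k - 2) * n%:R `^ delta <= n%:R ^+ l.-1 :> R.
Proof.
move=> /andP[l1 lk] n0 d0; set x : R := n%:R => hlam.
have x1 : 1 <= x by rewrite ler1n.
have x0 : 0 < x by apply: lt_le_trans x1.
have PD s t : x `^ (s + t) = x `^ s * x `^ t.
  by rewrite powRD // (gt_eqF x0) implybT.
have Px (m : nat) : x `^ m%:R = x ^+ m by rewrite powR_mulrn // ltW.
have k2 : k%:R - 2 = (k - 2)%:R :> R by rewrite natrB // ltnW // (leq_trans _ lk).
have l1R : l%:R - 1 = l.-1%:R :> R by rewrite -subn1 natrB // ltnW.
have k20 : 0 < (k - 2)%:R :> R by rewrite ltr0n subn_gt0 (leq_trans _ lk).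
move: hlam; rewrite k2 l1R; set s := _ / _ => hlam.
have sk : s * (k - 2)%:R = l.-1%:R by rewrite /s divfK // gt_eqF.
have s1 : s <= 1.
  by rewrite /s ler_pdivrMr // mul1r ler_nat; clear -lk l1; lia.
split.
  apply: (@le_trans _ _ (x `^ (s - delta) * x `^ delta)).
    by apply: ler_wpM2r => //; apply: powR_ge0.
  rewrite -PD subrK -Px; apply: ler_powR => //; apply: le_trans s1 _.
  by rewrite ler1n subn_gt0.
apply: (@le_trans _ _ ((x `^ (s - delta)) ^+ (k - 2) * x `^ delta)).
  by apply: ler_wpM2r; [apply: powR_ge0|apply: lerXn2r; rewrite ?nnegrE ?powR_ge0].
rewrite -powR_mulrn ?powR_ge0 // -powRrM -PD -Px; apply: ler_powR => //.
rewrite mulrBl sk -addrA gerDl addrC subr_le0 ler_peMr // ler1n.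
by rewrite -(ltr0n R).
Qed.

(* [n ^ eps] is spent on the sampling density, and the slack
   [delta] in the hypothesis on [lam] pays for the overlapping pairs and triangles. *)
Lemma system_alpha_ge_ln (R : realType) (k l lam n : nat) (H : {set {set 'I_n}})
    (delta eps K : R) :
  is_system k l lam H -> (1 < l < k)%N -> (0 < lam)%N -> (0 < n)%N ->
  0 < delta -> 0 < eps -> eps * k.-1%:R <= 1 -> 6 * eps * k.-1%:R ^+ 2 <= delta ->
  4 * 2 ^+ k <= K -> 4 * k%:R ^+ 3 <= K ->
  1 <= eps / 2 * ln n%:R -> K ^+ k.-1 <= n%:R `^ (delta / 2) ->
  lam%:R <= n%:R `^ ((l%:R - 1) / (k%:R - 2) - delta) ->
  (eps / 16 * ln n%:R * (n%:R ^+ (k - l) / lam%:R)) `^ (1 / k.-1%:R) / 4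
  <= (2 + 3 * 2 ^+ k) * (alpha H)%:R.
Proof.
move=> sysH lk lam0 n0 d0 e0 er1 er2 K2 K3 lnx Kx hlam.
have [F2 F3] := system_codegree_powR lk n0 (ltW d0) hlam.
have [l1 lk'] := andP lk.
set x : R := n%:R in lnx Kx F2 F3 *; set r := k.-1 in er1 er2 Kx *.
have r0 : (0 < r)%N by rewrite /r; clear -l1 lk'; lia.
have rR : 1 <= r%:R :> R by rewrite ler1n.
have x1 : 1 <= x by rewrite ler1n.
have x0 : 0 < x by apply: lt_le_trans x1.
have PD s t : x `^ (s + t) = x `^ s * x `^ t.
  by rewrite powRD // (gt_eqF x0) implybT.
have PX s (m : nat) : (x `^ s) ^+ m = x `^ (s * m%:R).
  by rewrite -powR_mulrn ?powR_ge0 // -powRrM.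
have la0 : 0 < lam%:R :> R by rewrite ltr0n.
have la1 : 1 <= lam%:R :> R by rewrite ler1n.
have K0 : 0 < K.
  by apply: lt_le_trans K2; rewrite mulr_gt0 // exprn_gt0.
pose D : R := lam%:R * x ^+ l.-1.
have D0 : 0 < D by rewrite mulr_gt0 // exprn_gt0.
pose G : R := x `^ (eps * r%:R).
have G0 : 0 < G by apply: powR_gt0.
have G1 : 1 <= G.
  rewrite -(powRr0 x); apply: ler_powR => //; rewrite mulr_ge0 // ltW //.
(* Half of [delta] pays for [K], the other half for [G]; hence the condition on [6 * eps]. *)
have KGd : K ^+ r * G ^+ (3 * r) <= x `^ delta.
  have -> : delta = delta / 2 + delta / 2 by lra.
  rewrite PD; apply: ler_pM => //; rewrite ?exprn_ge0 ?(ltW K0) ?(ltW G0) //.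
  rewrite PX; apply: ler_powR => //; rewrite natrM.
  by move: er2; rewrite expr2; lra.
pose t := eps / 2 * ln x; pose N := Num.truncn t.
have t0 : 0 <= t by apply: le_trans lnx.
have /andP[Nt tN] : N%:R <= t < N.+1%:R := truncn_itv t0.
have N0 : (0 < N)%N by rewrite -ltnS -(ltr_nat R) (le_lt_trans lnx).
have NR : 1 <= N%:R :> R by rewrite ler1n.
pose q : R := (G / D) `^ (1 / r%:R).
have GD0 : 0 < G / D by apply: divr_gt0.
have q0 : 0 < q by apply: powR_gt0.
have qr : q ^+ r = G / D by apply: exprn_root_powR => //; apply: ltW.
(* This will be [z * q]; it satisfies [y ^+ r * D = N / 4], the largest value allowed by
   [system_alpha_ge_density]. *)
pose y : R := (N%:R / (4 * D)) `^ (1 / r%:R).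
have NR0 : 0 < N%:R :> R := lt_le_trans ltr01 NR.
have ND0 : 0 < N%:R / (4 * D) by apply: divr_gt0 => //; apply: mulr_gt0.
have y0 : 0 < y by apply: powR_gt0.
have yr : y ^+ r = N%:R / (4 * D) by apply: exprn_root_powR => //; apply: ltW.
pose z := y / q.
have z0 : 0 < z by apply: divr_gt0.
have zq : z * q = y by rewrite /z divfK // gt_eqF.
have lePr (a b : R) : 0 <= a -> 0 <= b -> a ^+ r <= b ^+ r -> a <= b.
  by move=> a0 b0; rewrite ler_pXn2r.
have q1 : q <= 1.
  rewrite -(expr_le1 r0) ?(ltW q0) // qr ler_pdivrMr // mul1r.
  apply: (@le_trans _ _ x).
    by rewrite -[X in _ <= X]powRr1 ?(ltW x0) //; apply: ler_powR.
  rewrite -[X in X <= _]mul1r; apply: ler_pM (ltW x0) la1 _ => //.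
  by rewrite -[X in X <= _]expr1; apply: ler_weXn2l => //; clear -l1; lia.
have zN : z * (1 + N%:R^-1) ^+ (N * N - N) <= 1.
  have E0 : 0 < expR N%:R :> R by apply: expR_gt0.
  apply: (@le_trans _ _ (z * expR N%:R)).
    by rewrite ler_pM2l // expr1Dinv_le_expR // leq_subr.
  rewrite -(expr_le1 r0); last by rewrite mulr_ge0 // ltW.
  rewrite exprMn /z expr_div_n yr qr -expRM_natl.
  have -> : N%:R / (4 * D) / (G / D) = N%:R / (4 * G).
    by field; rewrite !gt_eqF.
  rewrite mulrAC ler_pdivrMr ?mulr_gt0 // mul1r.
  (* One factor pays for the [r]-th power of the growth of [z], the other for the [N] in
     [z ^+ r = N / (4 * G)]. This is why [t] carries [eps / 2]. *)
  have e1 : expR (r%:R * N%:R) * expR (r%:R * N%:R) <= G.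
    rewrite -expRD /G /powR gt_eqF // ler_expR.
    have : r%:R * N%:R <= r%:R * t by apply: ler_wpM2l => //; lra.
    by rewrite /t; lra.
  have e2 : N%:R <= expR (r%:R * N%:R) :> R.
    apply: le_trans (_ : 1 + N%:R <= _); first by rewrite lerDr.
    apply: le_trans (expR_ge1Dx _) _; rewrite ler_expR ler_peMl //.
  have := ler_wpM2r (expR_ge0 (r%:R * N%:R)) e2; lra.
have qx : K * G ^+ 3 <= q * x.
  apply: lePr; rewrite ?mulr_ge0 ?exprn_ge0 ?(ltW K0) ?(ltW G0) ?(ltW q0) ?(ltW x0) //.
  rewrite [(K * _) ^+ r]exprMn -exprM [(q * x) ^+ r]exprMn qr mulrAC ler_pdivlMr //.
  apply: (@le_trans _ _ (x `^ delta * D)); first by rewrite ler_pM2r.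
  apply: (@le_trans _ _ (1 * x ^+ r)); last by rewrite ler_pM2r // exprn_gt0.
  have -> : (r = (k - l) + l.-1)%N by rewrite /r; clear -l1 lk'; lia.
  rewrite mul1r exprD /D mulrA ler_pM2r ?exprn_gt0 //.
  by rewrite mulrC.
have Kq : K * G * lam%:R * q <= 1.
  rewrite -(expr_le1 r0); last by rewrite !mulr_ge0 // ltW.
  rewrite !exprMn qr mulrA ler_pdivrMr // mul1r.
  have -> : lam%:R ^+ r = lam%:R * lam%:R ^+ (k - 2) :> R.
    by rewrite -exprS; congr (_ ^+ _); rewrite /r; clear -l1 lk'; lia.
  have -> : K ^+ r * G ^+ r * (lam%:R * lam%:R ^+ (k - 2)) * G =
      lam%:R * (lam%:R ^+ (k - 2) * (K ^+ r * G ^+ r.+1)) by rewrite exprS; ring.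
  rewrite /D ler_pM2l //; apply: le_trans F3; apply: ler_wpM2l.
    by apply: exprn_ge0; apply: ltW.
  apply: le_trans KGd; apply: ler_wpM2l; first by apply: exprn_ge0; apply: ltW.
  by apply: ler_weXn2l => //; clear -r0; lia.
have cT : #|'I_n| = n by apply: card_ord.
have := @system_alpha_ge_density _ R k l lam N H q z D G K sysH lk lam0.
rewrite cT => /(_ n0 q0 q1 z0 N0 zN erefl).
rewrite -/r qr divfK ?gt_eqF // => /(_ erefl G1 K2 K3 qx Kq).
rewrite zq yr => main.
apply: le_trans (main _); last first.
  by rewrite le_eqVlt; apply/orP; left; apply/eqP; field; rewrite gt_eqF.
rewrite ler_pM2r ?invr_gt0 //.
apply: lePr; rewrite ?powR_ge0 ?mulr_ge0 ?(ltW y0) ?(ltW x0) //.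
have e20 : 0 < eps / 2 by apply: divr_gt0.
have L0 : 0 < ln x by rewrite -(pmulr_rgt0 _ e20); apply: lt_le_trans lnx.
rewrite exprn_root_powR //; last first.
  by rewrite !mulr_ge0 ?invr_ge0 ?exprn_ge0 // ltW.
rewrite exprMn yr.
have -> : N%:R / (4 * D) * x ^+ r = N%:R / 4 * (x ^+ (k - l) / lam%:R).
  have -> : (r = (k - l) + l.-1)%N by rewrite /r; clear -l1 lk'; lia.
  rewrite /D exprD; field; rewrite !gt_eqF // exprn_gt0 //.
apply: ler_wpM2r; first by rewrite divr_ge0 ?exprn_ge0 // ltW.
(* Rounding loses at most a factor 2, so [N / 4 >= t / 8], which gives the constant [eps / 16]. *)
have : t <= 2 * N%:R by move: tN NR; rewrite -[N.+1%:R]natr1; clear; lra.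
by rewrite /t; clear; lra.
Qed.

Theorem theorem1p6 (R : realType) (k l : nat) (delta : R) :
  (2 <= l)%N -> (l < k)%N -> 0 < delta ->
  exists c : R, 0 < c /\
  exists N : nat, forall n lam : nat, (N <= n)%N ->
    (0 < lam)%N ->
    lam%:R < n%:R `^ ((l%:R - 1) / (k%:R - 2) - delta) ->
    c * ((n%:R ^+ (k - l) / lam%:R) `^ (1 / (k%:R - 1))
         * (ln n%:R) `^ (1 / (k%:R - 1)))
      <= (fsys n k l lam)%:R.
Proof.
move=> l1 lk d0.
have k1R : k%:R - 1 = k.-1%:R :> R by rewrite -subn1 natrB // (leq_trans _ lk).
have r0 : (0 < k.-1)%N by clear -l1 lk; lia.
have rR : 1 <= k.-1%:R :> R by rewrite ler1n.
(* Capping [delta] at 1 secures [eps * k.-1 <= 1] as well. *)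
pose d := Num.min delta 1; pose eps := d / (6 * k.-1%:R ^+ 2).
have d'0 : 0 < d by rewrite lt_min d0 ltr01.
have r20 : 0 < 6 * k.-1%:R ^+ 2 :> R by rewrite mulr_gt0 // exprn_gt0 // (lt_le_trans _ rR).
have e0 : 0 < eps by apply: divr_gt0.
have eE : 6 * eps * k.-1%:R ^+ 2 = d by rewrite mulrAC mulrC divfK // gt_eqF.
have er2 : 6 * eps * k.-1%:R ^+ 2 <= delta by rewrite eE ge_min lexx.
have er1 : eps * k.-1%:R <= 1.
  have : d <= 1 by rewrite ge_min lexx orbT.
  have : eps * k.-1%:R <= eps * k.-1%:R ^+ 2 by rewrite ler_pM2l // expr2 ler_peMl.
  have : 0 < eps * k.-1%:R by rewrite mulr_gt0 // (lt_le_trans _ rR).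
  by move: eE; lra.
pose K : R := 4 * 2 ^+ k + 4 * k%:R ^+ 3.
have K2 : 4 * 2 ^+ k <= K by rewrite lerDl mulr_ge0 // exprn_ge0.
have K3 : 4 * k%:R ^+ 3 <= K by rewrite lerDr mulr_ge0 // exprn_ge0.
have K0 : 0 < K by apply: lt_le_trans K2; rewrite mulr_gt0 // exprn_gt0.
pose C : R := 2 + 3 * 2 ^+ k.
have C0 : 0 < C by rewrite addr_gt0 // mulr_gt0 // exprn_gt0.
pose c1 : R := (eps / 16) `^ (1 / k.-1%:R).
have c10 : 0 < c1 by apply: powR_gt0; lra.
exists (c1 / (4 * C)); split; first by rewrite divr_gt0 // mulr_gt0.
(* The first summand makes [eps / 2 * ln n] at least 1, the second makes [n] to the power
   [delta / 2] at least [K ^+ k.-1]. *)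
pose M := expR (2 / eps) + (K ^+ k.-1) `^ (2 / delta).
exists (Num.truncn M).+1 => n lam nM lam0 hlam.
have M0 : 0 <= M by rewrite addr_ge0 ?expR_ge0 ?powR_ge0.
have Mn : M <= n%:R.
  have /andP[_ h] := truncn_itv M0; apply: le_trans (ltW h) _.
  by rewrite ler_nat.
have n0 : (0 < n)%N by apply: leq_trans nM.
have x0 : 0 < n%:R :> R by rewrite ltr0n.
have lnx : 1 <= eps / 2 * ln n%:R.
  have h : expR (2 / eps) <= n%:R by apply: le_trans Mn; rewrite lerDl powR_ge0.
  have : 2 / eps <= ln n%:R by rewrite -[X in X <= _]expRK ler_ln // posrE ?expR_gt0.
  by rewrite ler_pdivrMr //; lra.
have Kx : K ^+ k.-1 <= n%:R `^ (delta / 2).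
  have h : (K ^+ k.-1) `^ (2 / delta) <= n%:R by apply: le_trans Mn; rewrite lerDr expR_ge0.
  have Kr : 0 <= K ^+ k.-1 by apply: exprn_ge0; apply: ltW.
  have d20 : 0 <= delta / 2 by rewrite divr_ge0 // ltW.
  have := ge0_ler_powR d20 (_ : _ \is Num.nneg) (_ : _ \is Num.nneg) h.
  rewrite !nnegrE powR_ge0 ler0n -powRrM => /(_ isT isT).
  by rewrite (_ : 2 / delta * (delta / 2) = 1) ?powRr1 //; field; rewrite gt_eqF.
have [H sysH <-] := fsys_attained n k l lam.
have lk2 : (1 < l < k)%N by rewrite l1.
have main := system_alpha_ge_ln sysH lk2 lam0 n0 d0 e0 er1 er2 K2 K3 lnx Kx (ltW hlam).
have L0 : 0 <= ln n%:R :> R by apply: ln_ge0; rewrite ler1n.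
have Q0 : 0 <= n%:R ^+ (k - l) / lam%:R :> R by rewrite divr_ge0 ?exprn_ge0.
have e160 : 0 <= eps / 16 by apply: divr_ge0 => //; apply: ltW.
have pE : (eps / 16 * ln n%:R * (n%:R ^+ (k - l) / lam%:R)) `^ (1 / k.-1%:R) =
    c1 * (ln n%:R `^ (1 / k.-1%:R) * (n%:R ^+ (k - l) / lam%:R) `^ (1 / k.-1%:R)).
  by rewrite (powRM _ (mulr_ge0 e160 L0) Q0) (powRM _ e160 L0) mulrA.
move: main; rewrite pE -/C k1R ler_pdivrMr // => main.
rewrite mulrAC ler_pdivrMr ?mulr_gt0 // [_ `^ _ * _]mulrC.
by apply: le_trans main _; rewrite [X in X <= _](_ : _ = (alpha H)%:R * (4 * C)) //; ring.
Qed.
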